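(* Let $V_R(\mathfrak{Q})$ be a separable right quaternionic Hilbert space and let $X=\{x_n\}_{n\in\mathbb{N}}$ be a Riesz basis for $V_R(\mathfrak{Q})$. Then $X$ is a frame for $V_R(\mathfrak{Q})$.
   Context: $\mathfrak{Q}$ is the skew field of real quaternions, with conjugation $q\mapsto\overline{q}$ and modulus $|q|=(\overline{q}q)^{1/2}$. A right quaternionic Hilbert space $V_R(\mathfrak{Q})$ is a right $\mathfrak{Q}$-vector space with a map $\langle\cdot|\cdot\rangle:V_R(\mathfrak{Q})\times V_R(\mathfrak{Q})\to\mathfrak{Q}$ satisfying $\overline{\langle v_1|v_2\rangle}=\langle v_2|v_1\rangle$, $\langle v|v\rangle>0$ for $v\neq 0$, $\langle v|v_1+v_2\rangle=\langle v|v_1\rangle+\langle v|v_2\rangle$, and $\langle v|uq\rangle=\langle v|u\rangle q$ for $q\in\mathfrak{Q}$, which is complete for the norm $\|u\|=\sqrt{\langle u|u\rangle}$. An operator $T$ on $V_R(\mathfrak{Q})$ is right linear if $T(v_1\alpha+v_2\beta)=T(v_1)\alpha+T(v_2)\beta$ for $\alpha,\beta\in\mathfrak{Q}$, and bounded if $\|T(v)\|\le K\|v\|$ for some $K\ge 0$ and all $v$. An orthonormal (Hilbert) basis $\{e_n\}_{n\in\mathbb{N}}$ of $V_R(\mathfrak{Q})$ is a sequence with $\langle e_i|e_j\rangle=\delta_{ij}$ whose right $\mathfrak{Q}$-linear span is dense in $V_R(\mathfrak{Q})$. A Riesz basis for $V_R(\mathfrak{Q})$ is a family of the form $\{U(e_n)\}_{n\in\mathbb{N}}$,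 where $\{e_n\}_{n\in\mathbb{N}}$ is an orthonormal basis of $V_R(\mathfrak{Q})$ and $U:V_R(\mathfrak{Q})\to V_R(\mathfrak{Q})$ is a bounded right linear bijective operator. A sequence $\{u_n\}_{n\in\mathbb{N}}$ in $V_R(\mathfrak{Q})$ is a frame for $V_R(\mathfrak{Q})$ if there exist real numbers $0<r_1\le r_2<\infty$ such that $r_1\|u\|^2\le\sum_{n\in\mathbb{N}}|\langle u_n|u\rangle|^2\le r_2\|u\|^2$ for all $u\in V_R(\mathfrak{Q})$. *)

(* Defs.v *)
From HB Require Import structures.
From mathcomp Require Import all_boot all_order all_algebra.
From mathcomp Require Import all_classical all_reals all_analysis.
From mathcomp Require Import ring.

Set Implicit Arguments.
Unset Strict Implicit.
Unset Printing Implicit Defensive.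

Import Order.TTheory GRing.Theory Num.Theory.
Import numFieldNormedType.Exports.
Local Open Scope classical_set_scope.
Local Open Scope ring_scope.

(* Quat a b c d is a + b i + c j + d k. *)
Record quat (R : Type) := Quat { qre : R; qim_i : R; qim_j : R; qim_k : R }.

Section QuatRing.
Variable R : rcfType.

Definition quat_tuple (q : quat R) : R * R * R * R :=
  (qre q, qim_i q, qim_j q, qim_k q).
Definition tuple_quat (t : R * R * R * R) : quat R :=
  let: (a, b, c, d) := t in Quat a b c d.
Lemma quat_tupleK : cancel quat_tuple tuple_quat.
Proof. by case. Qed.
HB.instance Definition _ := Choice.copy (quat R) (can_type quat_tupleK).

Definition qadd (p q : quat R) : quat R :=
  Quat (qre p + qre q) (qim_i p + qim_i q) (qim_j p + qim_j q)
       (qim_k p + qim_k q).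
Definition qopp (p : quat R) : quat R :=
  Quat (- qre p) (- qim_i p) (- qim_j p) (- qim_k p).
Definition qmul (p q : quat R) : quat R :=
  let: Quat a b c d := p in
  let: Quat a' b' c' d' := q in
  Quat (a * a' - b * b' - c * c' - d * d')
       (a * b' + b * a' + c * d' - d * c')
       (a * c' - b * d' + c * a' + d * b')
       (a * d' + b * c' - c * b' + d * a').
Definition qreal (r : R) : quat R := Quat r 0 0 0.

Lemma qaddA : associative qadd.
Proof. by move=> [????] [????] [????]; congr Quat; rewrite /= addrA. Qed.
Lemma qaddC : commutative qadd.
Proof. by move=> [????] [????]; congr Quat; rewrite /= addrC. Qed.
Lemma qadd0 : left_id (qreal 0) qadd.
Proof. by move=> [????]; congr Quat; rewrite /= add0r. Qed.
Lemma qaddN : left_inverse (qreal 0) qopp qadd.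
Proof. by move=> [????]; congr Quat; rewrite /= addNr. Qed.
HB.instance Definition _ := GRing.isZmodule.Build (quat R)
  qaddA qaddC qadd0 qaddN.

Lemma qmulA : associative qmul.
Proof. by move=> [????] [????] [????]; congr Quat; ring. Qed.
Lemma qmul1 : left_id (qreal 1) qmul.
Proof. by move=> [????]; congr Quat; ring. Qed.
Lemma qmulr1 : right_id (qreal 1) qmul.
Proof. by move=> [????]; congr Quat; ring. Qed.
Lemma qmulDl : left_distributive qmul qadd.
Proof. by move=> [????] [????] [????]; congr Quat; rewrite /=; ring. Qed.
Lemma qmulDr : right_distributive qmul qadd.
Proof. by move=> [????] [????] [????]; congr Quat; rewrite /=; ring. Qed.
Lemma qoner_neq0 : qreal 1 != 0.
Proof. by apply/eqP => -[] /eqP; rewrite oner_eq0. Qed.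
HB.instance Definition _ := GRing.Zmodule_isNzRing.Build (quat R)
  qmulA qmul1 qmulr1 qmulDl qmulDr qoner_neq0.

Definition qconj (q : quat R) : quat R :=
  Quat (qre q) (- qim_i q) (- qim_j q) (- qim_k q).

Lemma qconj_mul (q : quat R) : qconj q * q =
  qreal (qre q ^+ 2 + qim_i q ^+ 2 + qim_j q ^+ 2 + qim_k q ^+ 2).
Proof.
case: q => a b c d; rewrite /GRing.mul /= /qreal.
by congr Quat; ring.
Qed.

(* By qconj_mul, qconj q * q is real, so nothing is lost by taking qre. *)
Definition qabs (q : quat R) : R := Num.sqrt (qre (qconj q * q)).

Definition qpos (q : quat R) : Prop := exists2 r : R, 0 < r & q = qreal r.

End QuatRing.

(* A right vector space over the quaternions is a left module over the
   converse ring: in (quat R)^c the product of p and q is q * p, so the module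
   law reads (v *q p) *q q = v *q (p * q). *)
Definition rscale (R : rcfType) (V : lmodType (quat R)^c) (v : V) (q : quat R)
  : V := (q : (quat R)^c) *: v.
Notation "v *q q" := (rscale v q) (at level 40, left associativity,
  q at next level) : ring_scope.

Lemma rscaleA (R : rcfType) (V : lmodType (quat R)^c) (v : V) (p q : quat R) :
  (v *q p) *q q = v *q (p * q).
Proof. exact: scalerA. Qed.

Definition ip_norm (R : rcfType) (V : Type) (ip : V -> V -> quat R) (v : V)
  : R := Num.sqrt (qre (ip v v)).

Record rqHilbert (R : realType) := RQHilbert {
  rqh_sort :> lmodType (quat R)^c;
  ip : rqh_sort -> rqh_sort -> quat R;
  ip_conj : forall u v, qconj (ip u v) = ip v u;
  ip_pos : forall v : rqh_sort, v != 0 -> qpos (ip v v);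
  ip_addr : forall v u w, ip v (u + w) = ip v u + ip v w;
  ip_scaler : forall v u q, ip v (u *q q) = ip v u * q;
  ip_complete : forall u : nat -> rqh_sort,
    (forall eps : R, 0 < eps -> exists N : nat, forall m n : nat,
      (N <= m)%N -> (N <= n)%N -> ip_norm ip (u m - u n) < eps) ->
    exists l : rqh_sort, (fun n => ip_norm ip (u n - l)) @ \oo --> (0 : R)
}.

Section RQHilbertTheory.
Variables (R : realType) (V : rqHilbert R).

Definition hnorm (v : V) : R := ip_norm (@ip R V) v.

Definition hdense (A : set V) : Prop :=
  forall (v : V) (eps : R), 0 < eps -> exists2 a, A a & hnorm (v - a) < eps.

Definition hseparable : Prop := exists2 A : set V, countable A & hdense A.

Definition rspan (e : nat -> V) : set V :=
  [set v | exists (N : nat) (a : nat -> quat R), v = \sum_(i < N) e i *q a i].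

Definition orthonormal_basis (e : nat -> V) : Prop :=
  (forall i j, ip (e i) (e j) = (i == j)%:R) /\ hdense (rspan e).

Definition right_linear (T : V -> V) : Prop :=
  forall (v1 v2 : V) (a b : quat R),
    T (v1 *q a + v2 *q b) = T v1 *q a + T v2 *q b.

Definition bounded_op (T : V -> V) : Prop :=
  exists2 K : R, 0 <= K & forall v, hnorm (T v) <= K * hnorm v.

Definition riesz_basis (x : nat -> V) : Prop :=
  exists (e : nat -> V) (U : V -> V),
    [/\ orthonormal_basis e, right_linear U, bounded_op U, bijective U
      & forall n, x n = U (e n)].

(* The series of nonnegative terms is taken in the extended reals, so that the
   upper bound entails its convergence. *)
Definition frame (x : nat -> V) : Prop :=
  exists r1 r2 : R, [/\ 0 < r1, r1 <= r2
    & forall u : V,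
      ((r1 * hnorm u ^+ 2)%:E <=
         \sum_(0 <= n <oo) (qabs (ip (x n) u) ^+ 2)%:E <=
       (r2 * hnorm u ^+ 2)%:E)%E].

End RQHilbertTheory.

(* Main.v *)
Require Import Defs.
From mathcomp Require Import all_boot all_order all_algebra.
From mathcomp Require Import all_classical all_reals all_analysis.
From mathcomp Require Import ring lra.

Set Implicit Arguments.
Unset Strict Implicit.
Unset Printing Implicit Defensive.

Import Order.TTheory GRing.Theory Num.Theory.
Import numFieldNormedType.Exports.
Local Open Scope classical_set_scope.
Local Open Scope ring_scope.

(** Write x_n = U(e_n), with |Uv| <= K |v|.  Everything below works with the
    truncated energies S_N(u) = sum_(n < N) |<x_n|u>|^2 and with the vectors
    c_N = sum_(n < N) e_n <x_n|u>, which are the projections of U*u onto the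
    span of e_0, ..., e_(N-1).  Orthonormality of (e_n) gives the two identities
    |c_N|^2 = S_N(u) and <w|c_N> = <Uw|u> for w in that span, so the adjoint
    itself never has to be constructed.

    Upper bound ([energy_le]): S_N(u) = |c_N|^2 = <U c_N|u> <= K |c_N| |u| by
    Cauchy-Schwarz, hence S_N(u) <= K^2 |u|^2.

    Lower bound ([energy_ge]): one must bound |u| on the set D of those u all of
    whose energies are at most 1, the general case following by scaling.  For u
    in D, density of the span of (e_n) turns the second identity into
    |<Uw|u>| <= |w| for every w ([rip_image_le]).  Since U is onto, every vector
    v is some Uw, so D is weakly bounded, and the uniform boundedness principle
    ([uniform_boundedness]) says that D is bounded.  This replaces the appeal to
    a bounded inverse of U.

    The uniform boundedness principle is proved by a gliding hump, directly from
    completeness.  For all estimates the real part of <.|.> suffices; it is a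
    real inner product with the same norm. *)

(** * Quaternion identities *)

Section Quaternions.
Variable R : rcfType.
Implicit Types p q : quat R.

(** Exposes the coordinate formula, which [ring] cannot see through the ring
    structure. *)
Lemma qmulE p q : p * q = qmul p q.
Proof. by []. Qed.

Lemma qre_sum N (f : 'I_N -> quat R) :
  qre (\sum_(i < N) f i) = \sum_(i < N) qre (f i).
Proof. by elim/big_rec2: _ => [//|i x y _ <-]. Qed.

Lemma qconjD p q : qconj (p + q) = qconj p + qconj q.
Proof. by case: p q => [????] [????]; congr Quat; rewrite /= opprD. Qed.

Lemma qconjM p q : qconj (p * q) = qconj q * qconj p.
Proof.
by rewrite !qmulE; case: p q => [????] [????]; congr Quat; rewrite /=; ring.
Qed.

Lemma qreM_real q (s : R) : qre (q * qreal s) = s * qre q.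
Proof. by rewrite qmulE; case: q => [????] /=; ring. Qed.

Lemma qabs_sqr q : qabs q ^+ 2 = qre (qconj q * q).
Proof. by rewrite /qabs sqr_sqrtr // qconj_mul /= !addr_ge0 ?sqr_ge0. Qed.

Lemma qabs_sqrM_real q (s : R) : qabs (q * qreal s) ^+ 2 = s ^+ 2 * qabs q ^+ 2.
Proof. by rewrite !qabs_sqr !qmulE; case: q => [????] /=; ring. Qed.

End Quaternions.

(** * The underlying real inner product *)

Section RealInnerProduct.
Variables (R : realType) (V : rqHilbert R).
Implicit Types (u v w : V) (p q : quat R) (s : R).

Lemma rscaleDr v p q : v *q (p + q) = v *q p + v *q q.
Proof. exact: scalerDl. Qed.

Lemma rscale1 v : v *q 1 = v.
Proof. exact: scale1r. Qed.

Lemma rscale0 v : v *q 0 = 0.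
Proof. exact: scale0r. Qed.

Lemma ipDl u v w : ip (u + v) w = ip u w + ip v w.
Proof. by rewrite -ip_conj ip_addr qconjD !ip_conj. Qed.

Lemma ipZl u q w : ip (u *q q) w = qconj q * ip u w.
Proof. by rewrite -ip_conj ip_scaler qconjM ip_conj. Qed.

Lemma ip0r u : ip u 0 = 0.
Proof. by apply: (addIr (ip u 0)); rewrite -ip_addr !add0r. Qed.

Lemma ip0l u : ip 0 u = 0.
Proof. by apply: (addIr (ip 0 u)); rewrite -ipDl !add0r. Qed.

Lemma ip_suml N (f : nat -> V) (b : nat -> quat R) u :
  ip (\sum_(i < N) f i *q b i) u = \sum_(i < N) qconj (b i) * ip (f i) u.
Proof.
elim: N => [|N IH]; first by rewrite !big_ord0 ip0l.
by rewrite !big_ord_recr /= ipDl IH ipZl.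
Qed.

Lemma ip_sumr N (f : nat -> V) (b : nat -> quat R) u :
  ip u (\sum_(i < N) f i *q b i) = \sum_(i < N) ip u (f i) * b i.
Proof.
elim: N => [|N IH]; first by rewrite !big_ord0 ip0r.
by rewrite !big_ord_recr /= ip_addr IH ip_scaler.
Qed.

Definition rip u v : R := qre (ip u v).

Lemma ripC u v : rip u v = rip v u.
Proof. by rewrite /rip -(ip_conj v u). Qed.

Lemma ripDr u v w : rip u (v + w) = rip u v + rip u w.
Proof. by rewrite /rip ip_addr. Qed.

Lemma ripDl u v w : rip (u + v) w = rip u w + rip v w.
Proof. by rewrite /rip ipDl. Qed.

Lemma ripZr u v s : rip u (v *q qreal s) = s * rip u v.
Proof. by rewrite /rip ip_scaler qreM_real. Qed.

Lemma ripZl u v s : rip (v *q qreal s) u = s * rip v u.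
Proof. by rewrite ripC ripZr ripC. Qed.

Lemma ripNr u v : rip u (- v) = - rip u v.
Proof.
by apply: (addrI (rip u v)); rewrite -ripDr !subrr /rip ip0r.
Qed.

Lemma ripNl u v : rip (- v) u = - rip v u.
Proof. by rewrite ripC ripNr ripC. Qed.

Lemma rip_gt0 v : v != 0 -> 0 < rip v v.
Proof. by move=> /ip_pos [r r0]; rewrite /rip => ->. Qed.

Lemma rip_ge0 v : 0 <= rip v v.
Proof.
have [->|/rip_gt0/ltW//] := eqVneq v 0.
by rewrite /rip ip0r.
Qed.

Lemma hnorm_ge0 v : 0 <= hnorm v.
Proof. exact: sqrtr_ge0. Qed.

Lemma hnorm_sqr v : hnorm v ^+ 2 = rip v v.
Proof. by rewrite /hnorm /ip_norm sqr_sqrtr // rip_ge0. Qed.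

Lemma hnorm0 : hnorm (0 : V) = 0.
Proof. by rewrite /hnorm /ip_norm ip0r sqrtr0. Qed.

Lemma hnormN v : hnorm (- v) = hnorm v.
Proof. by rewrite /hnorm /ip_norm -!/(rip _ _) ripNl ripNr opprK. Qed.

Lemma hnormZ v s : hnorm (v *q qreal s) = `|s| * hnorm v.
Proof.
rewrite /hnorm /ip_norm -!/(rip _ _) ripZl ripZr mulrA -expr2.
by rewrite sqrtrM ?sqr_ge0 // sqrtr_sqr.
Qed.

(** The inequality is the nonnegativity of the squared norm of u |v|^2 - v (u, v),
    with (u, v) the real inner product, divided by |v|^2. *)
Lemma cauchy_schwarz u v : `|rip u v| <= hnorm u * hnorm v.
Proof.
rewrite -(@ler_pXn2r _ 2) ?nnegrE ?mulr_ge0 ?hnorm_ge0 //.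
rewrite real_normK ?num_real // exprMn !hnorm_sqr.
have [->|v0] := eqVneq v 0; first by rewrite /rip !ip0r expr0n /= mulr0.
have vv := rip_gt0 v0.
have := rip_ge0 (u *q qreal (rip v v) - v *q qreal (rip u v)).
rewrite !(ripDl, ripDr, ripNl, ripNr, ripZl, ripZr) (ripC v u).
by rewrite -subr_ge0 -(pmulr_rge0 _ vv); lra.
Qed.

Lemma ler_hnormD u v : hnorm (u + v) <= hnorm u + hnorm v.
Proof.
rewrite -(@ler_pXn2r _ 2) ?nnegrE ?addr_ge0 ?hnorm_ge0 //.
rewrite sqrrD !hnorm_sqr ripDl !ripDr (ripC v u).
have := le_trans (ler_norm _) (cauchy_schwarz u v); lra.
Qed.

Lemma ler_hdistD w u v : hnorm (u - v) <= hnorm (u - w) + hnorm (w - v).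
Proof. by have := ler_hnormD (u - w) (w - v); rewrite addrA subrK. Qed.

End RealInnerProduct.

(** * Uniform boundedness principle *)

Section UniformBoundedness.
Variables (R : realType) (V : rqHilbert R).

(** The constant 3/2 is the sum of the geometric series of ratio 1/3, so the
    distance from [v n] to the limit is at most the sum of the remaining steps. *)
Lemma geometric_steps_cvg (v : nat -> V) :
    (forall n, hnorm (v n.+1 - v n) <= 3^-1 ^+ n) ->
  exists l : V, forall n, hnorm (l - v n) <= 3 / 2 * 3^-1 ^+ n.
Proof.
move=> step.
have g0 n : 0 < 3^-1 ^+ n :> R by rewrite exprn_gt0 // invr_gt0.
have tail n k : hnorm (v (n + k)%N - v n)
    <= 3 / 2 * (3^-1 ^+ n - 3^-1 ^+ (n + k)).
  elim: k => [|k IH]; first by rewrite addn0 !subrr mulr0 hnorm0.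
  have := ler_hdistD (v (n + k)%N) (v (n + k.+1)%N) (v n).
  have := step (n + k)%N; rewrite addnS exprS.
  by move: IH (g0 (n + k)%N); lra.
have far n m : (n <= m)%N -> hnorm (v m - v n) <= 3 / 2 * 3^-1 ^+ n.
  move=> /subnKC <-; have := tail n (m - n)%N.
  by move: (g0 (n + (m - n))%N); lra.
have gto0 : (fun n => 3^-1 ^+ n : R) @ \oo --> (0 : R).
  by apply: cvg_expr; rewrite ger0_norm ?invr_ge0 // invf_lt1 // ltr1n.
have [l lP] : exists l : V,
    (fun n => ip_norm (@ip R V) (v n - l)) @ \oo --> (0 : R).
  apply: ip_complete => eps eps0.
  have [N _ NP] : \forall n \near \oo, `|(0 : R) - 3^-1 ^+ n| < eps / 3.
    by move/cvgrPdist_lt : gto0; apply; rewrite divr_gt0.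
  exists N => m n Nm Nn; rewrite -/(hnorm _).
  have := NP N (leqnn _); rewrite sub0r normrN gtr0_norm // => gN.
  have := ler_hdistD (v N) (v m) (v n).
  have := far _ _ Nm; have := far _ _ Nn.
  by rewrite -(hnormN (v n - _)) opprB; lra.
exists l => n; apply/ler_addgt0Pr => eps eps0.
have [M _ MP] : \forall m \near \oo, `|(0 : R) - hnorm (v m - l)| < eps.
  by move/cvgrPdist_lt : lP; apply.
have := MP (maxn M n) (leq_maxl _ _).
rewrite sub0r normrN ger0_norm ?hnorm_ge0 // -hnormN opprB.
have := far _ _ (leq_maxr M n).
by have := ler_hdistD (v (maxn M n)) l (v n); lra.
Qed.

(** Move from [v] by [s] along u/|u|, in the direction whose sign agrees with that
    of (v, u): the absolute value of the pairing then grows by s |u|. *)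
Lemma exists_near_large_rip (u v : V) s : 0 <= s ->
  exists2 w : V, hnorm (w - v) <= s & s * hnorm u <= `|rip w u|.
Proof.
move=> s0; have [->|u0] := eqVneq u 0.
  by exists v; rewrite ?subrr ?hnorm0 ?mulr0 ?normr_ge0.
have nu : 0 < hnorm u by rewrite sqrtr_gt0 rip_gt0.
pose t := s / hnorm u.
have t0 : 0 <= t by rewrite divr_ge0 // ltW.
have tu : t * rip u u = s * hnorm u.
  by rewrite -hnorm_sqr /t expr2 mulrA divfK ?gt_eqF.
have nt : `|t| * hnorm u = s by rewrite ger0_norm // divfK ?gt_eqF.
have su : 0 <= s * hnorm u by rewrite mulr_ge0 // ltW.
have [vu|vu] := leP 0 (rip v u).
  exists (v + u *q qreal t); first by rewrite addrC addKr hnormZ nt.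
  by rewrite ripDl ripZl tu ger0_norm ?addr_ge0 // lerDr.
exists (v + u *q qreal (- t)).
  by rewrite addrC addKr hnormZ normrN nt.
by rewrite ripDl ripZl mulNr tu ltr0_norm; lra.
Qed.

(** Gliding hump.  If D were unbounded, take u_n in D with
    |u_n| > 2 * 3^n * (n + 1), and build v_(n+1) from v_n by a step of length at
    most 3^-n making |(v_(n+1), u_n)| >= 3^-n |u_n|.  The steps after n + 1 have
    total length at most 3^-n / 2, so they destroy at most half of this, and the
    limit l satisfies |(l, u_n)| >= 3^-n |u_n| / 2 > n + 1 for all n, against the
    bound at the single vector l. *)
Theorem uniform_boundedness (D : set V) :
    (forall v : V, exists C : R, forall u, D u -> `|rip v u| <= C) ->
  exists2 M : R, 0 < M & forall u, D u -> hnorm u <= M.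
Proof.
move=> ptw; apply: contrapT => unb.
have big n : exists u, D u /\ 2 * 3 ^+ n * n.+1%:R < hnorm u.
  apply: contrapT => nou; apply: unb; exists (2 * 3 ^+ n * n.+1%:R).
    by rewrite !mulr_gt0 ?exprn_gt0 // ltr0n.
  by move=> u Du; rewrite leNgt; apply/negP => lt; apply: nou; exists u.
have [u uP] := choice big.
have kick (nv : nat * V) : exists w, hnorm (w - nv.2) <= 3^-1 ^+ nv.1
    /\ 3^-1 ^+ nv.1 * hnorm (u nv.1) <= `|rip w (u nv.1)|.
  have /(exists_near_large_rip (u nv.1) nv.2) [w] : 0 <= 3^-1 ^+ nv.1 :> R.
    by rewrite exprn_ge0 // invr_ge0.
  by exists w.
have [k kP] := choice kick.
pose v := fix v n := if n is m.+1 then k (m, v m) else 0.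
have [l lP] : exists l : V, forall n, hnorm (l - v n) <= 3 / 2 * 3^-1 ^+ n.
  by apply: geometric_steps_cvg => n; have [] := kP (n, v n).
have [C CP] := ptw l.
(* Any index with n + 1 > C gives the contradiction. *)
pose n := Num.truncn C.
have [Du un] := uP n.
have Cn : C < n.+1%:R by exact: truncnS_gt.
have [_ kn] := kP (n, v n).
have lu := CP _ Du.
have err := le_trans (cauchy_schwarz (l - v n.+1) (u n))
  (ler_wpM2r (hnorm_ge0 _) (lP n.+1)).
have : n.+1%:R < 3^-1 ^+ n * hnorm (u n) / 2.
  rewrite exprVn ltr_pdivlMr // ltr_pdivlMl ?exprn_gt0 //.
  by rewrite mulrA mulrC mulrA.
have : `|rip (v n.+1) (u n)| <= `|rip l (u n)| + `|rip (l - v n.+1) (u n)|.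
  rewrite ripDl ripNl.
  by rewrite -[X in `|X| <= _](subKr (rip l (u n))); apply: ler_normB.
by move: err kn; rewrite exprS /=; lra.
Qed.

End UniformBoundedness.

(** * Right linear operators on finite sums *)

Section RightLinear.
Variables (R : realType) (V : rqHilbert R) (T : V -> V).
Hypothesis linT : right_linear T.

Lemma right_linearD u v : T (u + v) = T u + T v.
Proof. by have := linT u v 1 1; rewrite !rscale1. Qed.

Lemma right_linearZ u q : T (u *q q) = T u *q q.
Proof. by have := linT u u q 0; rewrite !rscale0 !addr0. Qed.

Lemma right_linear_sum N (e : nat -> V) (b : nat -> quat R) :
  T (\sum_(i < N) e i *q b i) = \sum_(i < N) T (e i) *q b i.
Proof.
elim: N => [|N IH]; last first.
  by rewrite !big_ord_recr /= right_linearD right_linearZ IH.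
by rewrite !big_ord0; have := right_linearZ 0 0; rewrite !rscale0.
Qed.

End RightLinear.

(** * Energies of a vector against a Riesz basis *)

Section RieszBasis.
Variables (R : realType) (V : rqHilbert R) (e : nat -> V) (U : V -> V).
Hypothesis basis_e : orthonormal_basis e.
Hypothesis linU : right_linear U.
Variable K : R.
Hypothesis K0 : 0 <= K.
Hypothesis boundU : forall v, hnorm (U v) <= K * hnorm v.

Definition energy N (u : V) : R := \sum_(i < N) qabs (ip (U (e i)) u) ^+ 2.

(** Projection onto the span of e_0, ..., e_(N-1) of U*u, since
    <e_i|U*u> = <U e_i|u>. *)
Definition adjoint_part N (u : V) : V := \sum_(i < N) e i *q ip (U (e i)) u.

Lemma ip_basis_adjoint_part N u (i : 'I_N) :
  ip (e i) (adjoint_part N u) = ip (U (e i)) u.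
Proof.
rewrite /adjoint_part (ip_sumr N e (fun j => ip (U (e j)) u)) (bigD1 i) //=.
rewrite basis_e.1 eqxx mul1r big1 ?addr0 // => j ji.
by rewrite basis_e.1 (eq_sym (i : nat)) (negbTE (_ : (j : nat) != i)) // mul0r.
Qed.

(** The adjunction <w|U*u> = <Uw|u>; the truncation of U*u is invisible to [w] in
    the span of the first [N] basis vectors. *)
Lemma ip_adjoint_part N (b : nat -> quat R) u :
  ip (\sum_(i < N) e i *q b i) (adjoint_part N u)
  = ip (U (\sum_(i < N) e i *q b i)) u.
Proof.
rewrite right_linear_sum // ip_suml (ip_suml N (fun i => U (e i))).
by apply: eq_bigr => i _; rewrite ip_basis_adjoint_part.
Qed.

Lemma hnorm_adjoint_part N u : hnorm (adjoint_part N u) ^+ 2 = energy N u.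
Proof.
rewrite hnorm_sqr /rip {1}/adjoint_part (ip_suml N e (fun j => ip (U (e j)) u)).
rewrite qre_sum; apply: eq_bigr => i _.
by rewrite ip_basis_adjoint_part qabs_sqr.
Qed.

(** With c = [adjoint_part N u], the energy is |c|^2 = (Uc, u) <= K |c| |u|;
    divide by |c|. *)
Lemma energy_le N u : energy N u <= K ^+ 2 * hnorm u ^+ 2.
Proof.
rewrite -hnorm_adjoint_part -exprMn.
set c := adjoint_part N u.
rewrite ler_pXn2r ?nnegrE ?mulr_ge0 ?hnorm_ge0 //.
have [->|c0] := eqVneq (hnorm c) 0; first by rewrite mulr_ge0 ?hnorm_ge0.
have {}c0 : 0 < hnorm c by rewrite lt_def c0 hnorm_ge0.
rewrite -(ler_pM2l c0) -expr2 hnorm_sqr.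
have -> : rip c c = rip (U c) u.
  by rewrite /rip (ip_adjoint_part N (fun j => ip (U (e j)) u)).
apply: le_trans (ler_norm _) (le_trans (cauchy_schwarz _ _) _).
by rewrite mulrA (mulrC _ K) ler_wpM2r ?hnorm_ge0.
Qed.

Lemma energyZ N u s : energy N (u *q qreal s) = s ^+ 2 * energy N u.
Proof.
rewrite /energy mulr_sumr; apply: eq_bigr => i _.
by rewrite ip_scaler qabs_sqrM_real.
Qed.

(** Formally |(Uw, u)| = |(w, U*u)| <= |w| |U*u| with |U*u| <= 1.  For [w] in the
    span this is [ip_adjoint_part]; density and continuity of U extend it. *)
Lemma rip_image_le w u : (forall N, energy N u <= 1) -> `|rip (U w) u| <= hnorm w.
Proof.
move=> u1; apply/ler_addgt0Pr => eps eps0.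
(* An error d in approximating w costs d in |w| and K d |u| in (Uw, u). *)
pose B := 1 + K * hnorm u.
have B0 : 0 < B by rewrite ltr_pwDl // mulr_ge0 ?hnorm_ge0.
have [w' [N [b w'E]] ww'] := basis_e.2 w (eps / B) (divr_gt0 eps0 B0).
have -> : rip (U w) u = rip (U w') u + rip (U (w - w')) u.
  by rewrite -ripDl -right_linearD // addrC subrK.
have main : `|rip (U w') u| <= hnorm w'.
  rewrite /rip w'E -ip_adjoint_part -w'E -/(rip _ _).
  apply: le_trans (cauchy_schwarz _ _) _.
  rewrite ler_piMr ?hnorm_ge0 // -(@ler_pXn2r _ 2) ?nnegrE ?hnorm_ge0 //.
  by rewrite hnorm_adjoint_part expr1n.
have err : `|rip (U (w - w')) u| <= K * hnorm u * (eps / B).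
  apply: le_trans (cauchy_schwarz _ _) _.
  rewrite mulrAC; apply: (ler_wpM2r (hnorm_ge0 _)).
  by apply: le_trans (boundU _) _; rewrite ler_wpM2l // ltW.
have tri : hnorm w' <= hnorm w + eps / B.
  have := ler_hnormD w (w' - w); rewrite addrC subrK -(hnormN (w' - w)) opprB.
  by move: ww'; lra.
have epsE : eps / B + K * hnorm u * (eps / B) = eps.
  by rewrite -[X in X + _]mul1r -mulrDl mulrC divfK ?gt_eqF.
by apply: le_trans (ler_normD _ _) _; lra.
Qed.

Hypothesis bijU : bijective U.

(** |U*u| bounds |u| from above up to a constant, because U is onto.  Stating this
    for strictly positive [T] allows u to be rescaled by 1 / sqrt T into the set
    where all energies are at most 1. *)
Lemma energy_ge : exists2 r : R, 0 < r &
  forall u T, 0 < T -> (forall N, energy N u <= T) -> r * hnorm u ^+ 2 <= T.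
Proof.
have [U' _ U'K] := bijU.
have [M M0 MP] : exists2 M : R, 0 < M &
    forall u, (forall N, energy N u <= 1) -> hnorm u <= M.
  apply: uniform_boundedness => v; exists (hnorm (U' v)) => u u1.
  by rewrite -{1}(U'K v); apply: rip_image_le.
exists (M ^- 2) => [|u T T0 uT]; first by rewrite invr_gt0 exprn_gt0.
pose s := (Num.sqrt T)^-1.
have s2 : s ^+ 2 = T^-1 by rewrite exprVn sqr_sqrtr // ltW.
have : hnorm (u *q qreal s) <= M.
  by apply: MP => N; rewrite energyZ s2 ler_pdivrMl // mulr1.
rewrite hnormZ -(@ler_pXn2r _ 2) ?nnegrE ?mulr_ge0 ?hnorm_ge0 ?(ltW M0) //.
rewrite exprMn real_normK ?num_real // s2 => sM.
by rewrite ler_pdivrMl ?exprn_gt0 // mulrC -ler_pdivrMl.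
Qed.

End RieszBasis.

(** * Riesz bases are frames *)

Theorem theorem3p4 (R : realType) (V : rqHilbert R) (x : nat -> V) :
  hseparable V -> riesz_basis x -> frame x.
Proof.
move=> _ [e [U [basis_e linU [K K0 boundU] bijU xE]]].
have {x xE} -> : x = U \o e by apply/funext.
have [r r0 rP] := energy_ge basis_e linU K0 boundU bijU.
exists r, (Num.max r (K ^+ 2)); split=> [//||u]; first by rewrite le_max lexx.
pose f n := (qabs (ip (U (e n)) u) ^+ 2)%:E.
have f0 n : (0 <= n)%N -> true -> (0 <= f n)%E by rewrite lee_fin sqr_ge0.
have partE N : (\sum_(0 <= n < N) f n = (energy e U N u)%:E)%E.
  by rewrite big_mkord /energy -sumEFin.
have upper : (\sum_(0 <= n <oo) f n <= (K ^+ 2 * hnorm u ^+ 2)%:E)%E.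
  apply: lime_le; first exact: is_cvg_nneseries.
  by apply: nearW => N; rewrite partE lee_fin energy_le.
apply/andP; split; last first.
  apply: le_trans upper _.
  by rewrite lee_fin ler_wpM2r ?sqr_ge0 // le_max lexx orbT.
have sfin : (\sum_(0 <= n <oo) f n)%E \is a fin_num.
  rewrite ge0_fin_numE; first exact: le_lt_trans upper (ltry _).
  exact: nneseries_ge0.
have part_le N : energy e U N u <= fine (\sum_(0 <= n <oo) f n)%E.
  by rewrite -lee_fin fineK // -partE; apply: nneseries_lim_ge.
have s0 : 0 <= fine (\sum_(0 <= n <oo) f n)%E.
  by apply: le_trans (part_le 0%N); rewrite /energy big_ord0.
(* The sum of the series may vanish, while energy_ge needs a positive bound. *)
rewrite -(fineK sfin) lee_fin; apply/ler_addgt0Pr => eps eps0.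
apply: rP => [|N]; first by rewrite ltr_wpDl.
by rewrite ler_wpDr // ltW.
Qed.
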